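(* Let $(R,\mathfrak m,K)$ be a local ring of Krull dimension $d$ and let $\underline x=x_1,\dots,x_d$ and $\underline y=y_1,\dots,y_d$ be two systems of parameters for $R$. Then there exist positive constants $C,C'$, independent of $i$ and $M$, such that for all $1\le i\le d$ and for every finitely generated $R$-module $M$, $\sigma_i(\underline x;M)\le C\,\sigma_i(\underline y;M)$ and $\sigma_i(\underline y;M)\le C'\,\sigma_i(\underline x;M)$.
   Context: A local ring is Noetherian with a unique maximal ideal. For a system of parameters $\underline x$ of $R$ and a finitely generated $R$-module $M$, $h_i(\underline x;M)=\ell(H_i(\underline x;M))$ is the length of the $i$th Koszul homology module, and $\sigma_i(\underline x;M)=\sum_{j=i}^d h_j(\underline x;M)$. *)

(* Defs.v *)
From HB Require Import structures.
From mathcomp Require Import all_boot all_order all_algebra.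
From mathcomp Require Import boolp classical_sets reals constructive_ereal ereal.

Set Implicit Arguments.
Unset Strict Implicit.
Unset Printing Implicit Defensive.

Import Order.TTheory GRing.Theory Num.Theory.

Local Open Scope ring_scope.
Local Open Scope quotient_scope.

Definition strict_chain (T : Type) (n : nat) (N : nat -> {pred T}) : Prop :=
  forall k, (k < n)%N ->
    {subset N k <= N k.+1} /\ ~ {subset N k.+1 <= N k}.

Definition lspan (R : pzRingType) (V : lmodType R) (n : nat) (g : 'I_n -> V)
    (v : V) : Prop :=
  exists c : 'I_n -> R, v = \sum_(i < n) c i *: g i.

Definition finitely_generated (R : pzRingType) (M : lmodType R) : Prop :=
  exists (n : nat) (g : 'I_n -> M), forall v, lspan g v.

(* The ideals of [R] are the submodules of [R^o]; [idealr_closed] of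
   ring_quotient, used below, is the predicate of PROPER ideals. *)
Definition noetherian_ring (R : comNzRingType) : Prop :=
  forall I : {pred R^o}, submod_closed I ->
    exists (n : nat) (g : 'I_n -> R^o), forall a, a \in I <-> lspan g a.

Definition maximal_ideal (R : comNzRingType) (m : {pred R}) : Prop :=
  idealr_closed m /\
  forall J : {pred R}, idealr_closed J -> {subset m <= J} -> {subset J <= m}.

Definition local_ring (R : comNzRingType) (m : {pred R}) : Prop :=
  [/\ noetherian_ring R, maximal_ideal m &
      forall m' : {pred R}, maximal_ideal m' -> m' =i m].

Definition prime_ideal (R : comNzRingType) (P : {pred R}) : Prop :=
  idealr_closed P /\ prime_idealr_closed P.

Definition prime_chain (R : comNzRingType) (n : nat) : Prop :=
  exists P : nat -> {pred R},
    (forall k, (k <= n)%N -> prime_ideal (P k)) /\ strict_chain n P.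

Definition krull_dim (R : comNzRingType) (d : nat) : Prop :=
  prime_chain R d /\ forall n, prime_chain R n -> (n <= d)%N.

(* The radical of (x_1, ..., x_d) is [m], where [m] is the maximal ideal of a
   local ring of Krull dimension [d]. *)
Definition system_of_parameters (R : comNzRingType) (m : {pred R}) (d : nat)
    (x : 'I_d -> R) : Prop :=
  forall a : R,
    a \in m <-> exists k : nat, lspan (x : 'I_d -> R^o) (a ^+ k : R^o).

Definition submodule_chain (R : pzRingType) (V : lmodType R) (n : nat) : Prop :=
  exists N : nat -> {pred V},
    (forall k, (k <= n)%N -> submod_closed (N k)) /\ strict_chain n N.

Definition mod_length (F : realType) (R : pzRingType) (V : lmodType R)
    : \bar F :=
  ereal_sup [set (n%:R : F)%:E | n in [set n : nat | submodule_chain V n]].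

Section QuotientModule.
Variables (R : pzRingType) (V : lmodType R) (B : {pred V}).
Variable hB : submod_closed B.

(* [B], carrying a proof [hB] so that the instance below can be inferred. *)
Definition submod_pred (_ : submod_closed B) : {pred V} := B.

HB.instance Definition _ :=
  GRing.isSubmodClosed.Build R V (submod_pred hB) hB.

Definition quot_mod : Type := {ideal_quot (submod_pred hB)}.

HB.instance Definition _ := EqQuotient.on quot_mod.
HB.instance Definition _ := GRing.Zmodule.on quot_mod.

Definition quot_scale (a : R) (u : quot_mod) : quot_mod :=
  \pi_quot_mod (a *: repr u).

Lemma quot_scale_pi a v :
  quot_scale a (\pi_quot_mod v) = \pi_quot_mod (a *: v).
Proof.
apply/eqP; rewrite -Quotient.idealrBE -scalerBr rpredZ //.
by rewrite Quotient.idealrBE reprK.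
Qed.

Lemma pi_quot_modD : {morph \pi_quot_mod : u v / u + v}.
Proof. by move=> u v; rewrite Quotient.pi_add. Qed.

Fact quot_scaleA a b u : quot_scale a (quot_scale b u) = quot_scale (a * b) u.
Proof. by elim/quotW: u => u; rewrite (quot_scale_pi b u) !quot_scale_pi scalerA. Qed.

Fact quot_scale1 : left_id 1 quot_scale.
Proof. by elim/quotW=> u; rewrite quot_scale_pi scale1r. Qed.

Fact quot_scaleDr : right_distributive quot_scale +%R.
Proof.
move=> a u v; elim/quotW: u => u; elim/quotW: v => v.
by rewrite -pi_quot_modD !quot_scale_pi scalerDr pi_quot_modD.
Qed.

Fact quot_scaleDl u : {morph quot_scale^~ u : a b / a + b}.
Proof.
by move=> a b; elim/quotW: u => u; rewrite !quot_scale_pi scalerDl pi_quot_modD.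
Qed.

HB.instance Definition _ := GRing.Zmodule_isLmodule.Build R quot_mod
  quot_scaleA quot_scale1 quot_scaleDr quot_scaleDl.

End QuotientModule.

Section Koszul.
Variables (R : comNzRingType) (n : nat) (x : 'I_n -> R) (M : lmodType R).

(* K(x; M) as the direct sum of the M e_S, S a subset of {0, ..., n-1}, with
   e_S = e_{s_1} /\ ... /\ e_{s_p} for s_1 < ... < s_p in degree p = #|S|;
   [phi S] is the coefficient of [phi] at e_S. *)
Definition koszul : Type := {ffun {set 'I_n} -> M}.

HB.instance Definition _ := GRing.Lmodule.on koszul.

Definition koszul_sign (T : {set 'I_n}) (s : 'I_n) : R :=
  (-1) ^+ #|[set t in T | (t < s)%N]|.

(* d (v e_S) = \sum_j (-1)^(j-1) x_{s_j} v e_{S \ s_j}: the coefficient of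
   d phi at e_T collects the S = s |: T with s not in T. *)
Definition koszul_diff (phi : koszul) : koszul :=
  [ffun T : {set 'I_n} =>
    \sum_(s | s \notin T) (koszul_sign T s * x s) *: phi (s |: T)].

Fact koszul_diff_is_linear : linear koszul_diff.
Proof.
move=> a u v; apply/ffunP => T; rewrite !ffunE scaler_sumr -big_split /=.
apply: eq_bigr => s _; rewrite !ffunE scalerDr !scalerA.
by rewrite [a * _]mulrC.
Qed.

HB.instance Definition _ :=
  GRing.isLinear.Build R koszul koszul _ koszul_diff koszul_diff_is_linear.

Lemma koszul_signU1 (T : {set 'I_n}) (s t : 'I_n) : s \notin T ->
  koszul_sign (s |: T) t = (-1) ^+ (s < t)%N * koszul_sign T t.
Proof.
move=> sT; rewrite /koszul_sign -exprD; congr (_ ^+ _).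
have [st|ts] := boolP (s < t)%N.
  rewrite [LHS](cardsD1 s) !inE eqxx st /= add1n.
  congr _.+1; apply: eq_card => u; rewrite !inE.
  by have [->|] //= := eqVneq u s; rewrite (negbTE sT).
apply: eq_card => u; rewrite !inE.
by have [->|] //= := eqVneq u s; rewrite (negbTE sT) (negbTE ts).
Qed.

Lemma koszul_diffK (phi : koszul) : koszul_diff (koszul_diff phi) = 0.
Proof.
apply/ffunP => T; rewrite !ffunE.
pose F s t := (koszul_sign T s * koszul_sign T t * x s * x t) *:
  phi (t |: (s |: T)).
pose P (s t : 'I_n) := (s \notin T) && (t \notin T).
have FC s t : F s t = F t s.
  by rewrite /F finset.setUCA [koszul_sign T s * _]mulrC -!mulrA [x s * _]mulrC.
transitivity (\sum_s \sum_(t | P s t && (t < s)%N) F s t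
  - \sum_s \sum_(t | P s t && (s < t)%N) F s t).
  rewrite -sumrB big_mkcond; apply: eq_bigr => s _; rewrite /P.
  case: ifPn => sT /=; last by rewrite !big_pred0_eq subrr.
  rewrite ffunE scaler_sumr (bigID (fun t : 'I_n => (t < s)%N)) /=.
  rewrite -sumrN; congr (_ + _).
    apply: eq_big => [t|t /andP[tT ts]].
      rewrite !inE negb_or; have [->|] //= := eqVneq t s.
      by rewrite ltnn andbF.
    rewrite scalerA koszul_signU1 // ltnNge (ltnW ts) mul1r.
    by rewrite mulrACA mulrA.
  apply: eq_big => [t|t /andP[tT ts]].
    rewrite !inE negb_or -leqNgt [in RHS]ltn_neqAle.
    by rewrite -[_ == _ :> nat]/(s == t) eq_sym andbCA andbA.
  rewrite scalerA koszul_signU1 //.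
  have -> : (s < t)%N.
    move: tT ts; rewrite !inE negb_or -leqNgt => /andP[ts _] st.
    by rewrite ltn_neqAle st andbT eq_sym.
  by rewrite expr1 mulN1r !mulNr mulrN scaleNr mulrACA mulrA.
apply/eqP; rewrite subr_eq0; apply/eqP.
rewrite (exchange_big_dep xpredT) //=; apply: eq_bigr => s _.
by apply: eq_big => [t|t _]; [congr (_ && _); apply: andbC | exact: FC].
Qed.

Definition koszul_homog (p : nat) : {pred koszul} :=
  [pred phi : koszul | [forall S : {set 'I_n}, (#|S| != p) ==> (phi S == 0)]].

Definition koszul_cycle (p : nat) : {pred koszul} :=
  [pred phi | (phi \in koszul_homog p) && (koszul_diff phi == 0)].

Lemma koszul_homogP p (phi : koszul) :
  reflect (forall S : {set 'I_n}, #|S| != p -> phi S = 0)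
          (phi \in koszul_homog p).
Proof.
by apply: (iffP 'forall_implyP) => h S /h /eqP.
Qed.

Fact koszul_homog_submod p : submod_closed (koszul_homog p).
Proof.
split=> [|a u v /koszul_homogP hu /koszul_homogP hv].
  by apply/koszul_homogP => S _; rewrite ffunE.
by apply/koszul_homogP => S hS; rewrite !ffunE hu // hv // scaler0 addr0.
Qed.

HB.instance Definition _ p :=
  GRing.isSubmodClosed.Build R koszul (koszul_homog p) (koszul_homog_submod p).

Fact koszul_cycle_submod p : submod_closed (koszul_cycle p).
Proof.
split=> [|a u v /andP[hu /eqP du] /andP[hv /eqP dv]]; apply/andP; split.
- exact: rpred0.
- by rewrite linear0.
- by rewrite rpredD ?rpredZ.
- by rewrite linearP /= du dv scaler0 addr0.
Qed.

HB.instance Definition _ p :=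
  GRing.isSubmodClosed.Build R koszul (koszul_cycle p) (koszul_cycle_submod p).

Definition koszul_cycles (p : nat) : Type :=
  {phi : koszul | phi \in koszul_cycle p}.

HB.instance Definition _ p := SubChoice.on (koszul_cycles p).
HB.instance Definition _ p := [SubChoice_isSubLmodule of koszul_cycles p by <:].

Definition koszul_boundary (p : nat) : {pred koszul_cycles p} :=
  [pred z : koszul_cycles p |
    `[< exists2 w : koszul, w \in koszul_homog p.+1 & val z = koszul_diff w >]].

Fact koszul_boundary_submod p : submod_closed (@koszul_boundary p).
Proof.
split=> [|a u v /asboolP[w hw dw] /asboolP[w' hw' dw']]; apply/asboolP.
  by exists 0; [exact: rpred0 | rewrite !linear0].
exists (a *: w + w'); first by rewrite rpredD ?rpredZ.
by rewrite !linearP /= dw dw'.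
Qed.

Definition koszul_homology (p : nat) : lmodType R :=
  quot_mod (koszul_boundary_submod p).

End Koszul.

Definition koszul_length (F : realType) (R : comNzRingType) (n : nat)
    (x : 'I_n -> R) (M : lmodType R) (i : nat) : \bar F :=
  mod_length F (koszul_homology x M i).

Definition koszul_sigma (F : realType) (R : comNzRingType) (d : nat)
    (x : 'I_d -> R) (M : lmodType R) (i : nat) : \bar F :=
  (\sum_(i <= j < d.+1) koszul_length F x M j)%E.

(* Main.v *)
(* For any sequence [z] and element [w], there are exact sequences
     0 -> H_{j+1}(z) / w H_{j+1}(z) -> H_{j+1}(z, w) -> (0 : w) in H_j(z) -> 0.
   Hence [h_{j+1}(z, w) <= h_{j+1}(z) + h_j(z)]; and if [w^k] lies in the ideal
   [(z)], then [w^k] kills [H_j(z)], so filtering by the kernels of the powers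
   of [w] gives [h_j(z) <= k * h_{j+1}(z, w)].
   Adjoining the [d] elements of [x] to [y] by the second bound, then removing
   [y] from [(x, y)] by the first one, yields
     sigma_i(y) <= k^d sigma_{i+d}(x, y) <= k^d 2^d sigma_i(x).
   All the intermediate complexes are realised inside [K(x, y; M)], as the
   chains supported on the subsets of a fixed set [A] of indices. *)
Require Import Defs.
From HB Require Import structures.
From mathcomp Require Import all_boot all_order all_algebra.
From mathcomp Require Import boolp classical_sets reals constructive_ereal ereal.

Set Implicit Arguments.
Unset Strict Implicit.
Unset Printing Implicit Defensive.

Import Order.TTheory GRing.Theory Num.Theory.

Local Open Scope ring_scope.

(** * Submodules as classical sets *)

Definition submodule (R : pzRingType) (V : lmodType R) (L : set V) : Prop :=
  L 0 /\ forall a u v, L u -> L v -> L (a *: u + v).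

Section Submodule.
Variables (R : pzRingType) (V : lmodType R) (L : set V).
Hypothesis hL : submodule L.

Lemma submodule0 : L 0. Proof. exact: hL.1. Qed.

Lemma submoduleD u v : L u -> L v -> L (u + v).
Proof. by rewrite -{2}[u]scale1r; apply: hL.2. Qed.

Lemma submoduleZ a u : L u -> L (a *: u).
Proof. by move=> Lu; rewrite -[_ *: _]addr0; apply: hL.2 => //; apply: hL.1. Qed.

Lemma submoduleB u v : L u -> L v -> L (u - v).
Proof. by move=> Lu Lv; rewrite addrC -scaleN1r; apply: hL.2. Qed.

End Submodule.

(** * Length of a subquotient and its behaviour along maps and exact sequences *)

Section RelativeLength.
Variables (F : realType) (R : pzRingType).

(** The top term is an index, so that chains grow upwards and an induction can carry along the
    transform of the top under a linear map. A chain may start above [B] and stop below [A]. *)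
Inductive chain_to (V : lmodType R) (A B : set V) : nat -> set V -> Prop :=
| Chain0 L of submodule L & (B `<=` L)%classic & (L `<=` A)%classic :
    chain_to A B 0 L
| ChainS n L L' of chain_to A B n L & submodule L' & (L `<=` L')%classic &
    ~ (L' `<=` L)%classic & (L' `<=` A)%classic : chain_to A B n.+1 L'.

(* The length of [A / B] for submodules [B] of [A]; the junk value is [-oo] when
   no submodule lies between them. *)
Definition rlength (V : lmodType R) (A B : set V) : \bar F :=
  ereal_sup [set (n%:R : F)%:E | n in [set n | exists L, chain_to A B n L]].

Lemma chain_to_bounds (V : lmodType R) (A B : set V) n L : chain_to A B n L ->
  [/\ submodule L, (B `<=` L)%classic & (L `<=` A)%classic].
Proof.
elim=> // {}n {}L L' _ [_ BL _] sL' LL' _ L'A; split => //.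
exact: subset_trans LL'.
Qed.

Lemma rlength_ubound (V : lmodType R) (A B : set V) n L :
  chain_to A B n L -> ((n%:R : F)%:E <= rlength A B)%E.
Proof. by move=> c; apply: ereal_sup_ubound; exists n => //; exists L. Qed.

Lemma rlength_le (V : lmodType R) (A B : set V) (b : \bar F) :
  (forall n L, chain_to A B n L -> ((n%:R : F)%:E <= b)%E) ->
  (rlength A B <= b)%E.
Proof. by move=> h; apply: ge_ereal_sup => _ [n [L c] <-]; apply: h c. Qed.

Lemma rlength_ge0 (V : lmodType R) (A B : set V) :
  submodule A -> (B `<=` A)%classic -> (0 <= rlength A B)%E.
Proof.
move=> sA BA; apply: (@rlength_ubound _ _ _ 0%N A).
by apply: Chain0.
Qed.

Lemma rlength0 (V : lmodType R) (A B : set V) :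
  (A `<=` B)%classic -> (rlength A B <= 0)%E.
Proof.
move=> AB; apply: rlength_le => n L; case=> // {}n {}L L' c _ _ nL'L L'A.
case: nL'L => v /L'A /AB; have [_ BL _] := chain_to_bounds c.
exact: BL.
Qed.

(** A chain is pulled back to [A] along [f]; strict inclusions stay strict because every element of
    [C] is hit from [A]. *)
Lemma rlength_surj (U V : lmodType R) (f : {linear U -> V}) (A B : set U)
    (C D : set V) :
  submodule A -> (B `<=` A)%classic ->
  (forall b, B b -> D (f b)) ->
  (forall c, C c -> exists2 a, A a & f a = c) ->
  (rlength C D <= rlength A B)%E.
Proof.
move=> sA BA fB fA; apply: rlength_le => n L c.
apply: (@rlength_ubound _ _ _ _ (fun a => A a /\ L (f a))).
have sub L0 : submodule L0 -> submodule (fun a => A a /\ L0 (f a)).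
  move=> sL; split; first by split; [exact: sA.1 | rewrite linear0; exact: sL.1].
  move=> a u v [Au Lu] [Av Lv]; split; first exact: sA.2.
  by rewrite linearP; apply: sL.2.
elim: c => {n L} [L sL DL LC|n L L' _ IH sL' LL' nL'L L'C].
  by apply: Chain0; [exact: sub | move=> b Bb; split; [exact: BA | exact/DL/fB]
    | move=> a []].
apply: ChainS IH _ _ _ _; first exact: sub.
- by move=> a [Aa /LL' La].
- move=> h; apply: nL'L => v L'v; have [a Aa fa] := fA _ (L'C _ L'v).
  by rewrite -fa in L'v *; exact: (h a (conj Aa L'v)).2.
- by move=> a [].
Qed.

(* The hypotheses say that [A1 / B1 -> A / B -> A2 / B2] is exact in the middle,
   where [g] need not map [A1] into [A]. *)
Lemma rlength_exact (U V W : lmodType R) (g : {linear U -> V})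
    (f : {linear V -> W}) (A1 B1 : set U) (A B : set V) (A2 B2 : set W) :
  submodule A1 -> submodule A2 -> submodule B2 ->
  (B1 `<=` A1)%classic -> (B2 `<=` A2)%classic ->
  (forall b, B1 b -> B (g b)) -> (forall a, A a -> A2 (f a)) ->
  (forall a, A a -> B2 (f a) -> exists b u, [/\ B b, A1 u & a = b + g u]) ->
  (rlength A B <= rlength A1 B1 + rlength A2 B2)%E.
Proof.
move=> sA1 sA2 sB2 BA1 BA2 gB fA ex; apply: rlength_le => n L c.
(* [P L] is the trace of [L] on the left term and [Q L] its image in the right term, enlarged by
   [B2]. Each strict step of a chain in the middle must enlarge at least one of them. *)
pose P (L : set V) : set U := fun u => A1 u /\ L (g u).
pose Q (L : set V) : set W := fun w => exists2 a, L a & B2 (w - f a).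
have subP L0 : submodule L0 -> submodule (P L0).
  move=> sL; split; first by split; [exact: sA1.1 | rewrite linear0; exact: sL.1].
  move=> a u v [Au Lu] [Av Lv]; split; first exact: sA1.2.
  by rewrite linearP; apply: sL.2.
have subQ L0 : submodule L0 -> submodule (Q L0).
  move=> sL; split.
    by exists 0; [exact: sL.1 | rewrite linear0 subr0; exact: sB2.1].
  move=> a u v [u' Lu Bu] [v' Lv Bv]; exists (a *: u' + v'); first exact: sL.2.
  by rewrite linearP opprD addrACA -scalerBr; apply: sB2.2.
have QA L0 : (L0 `<=` A)%classic -> (Q L0 `<=` A2)%classic.
  move=> LA w [a /LA /fA fa /BA2 h]; rewrite -[w](subrK (f a)).
  exact: submoduleD.
suff [p [q [npq cp cq]]] : exists p q,
    [/\ (n <= p + q)%N, chain_to A1 B1 p (P L) & chain_to A2 B2 q (Q L)].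
  apply: (@le_trans _ _ ((p%:R : F)%:E + (q%:R : F)%:E)%E).
    by rewrite -EFinD lee_fin -natrD ler_nat.
  by apply: leeD; [exact: rlength_ubound cp | exact: rlength_ubound cq].
elim: c => {n L} [L sL BL LA|n L L' c [p [q [npq cp cq]]] sL' LL' nL'L L'A].
  exists 0%N, 0%N; split=> //.
    by apply: Chain0; [exact: subP | move=> b Bb; split; [exact: BA1|exact/BL/gB]
      | move=> u []].
  apply: Chain0; [exact: subQ | move=> w Bw | exact: QA].
  by exists 0; [exact: sL.1 | rewrite linear0 subr0].
have [sL BL LA] := chain_to_bounds c.
have PP : (P L `<=` P L')%classic by move=> u [Au /LL' Lu].
have QQ : (Q L `<=` Q L')%classic by move=> w [a /LL' La Ba]; exists a.
(* If neither grows, take [a] in [L'] and [a'] in [L] with the same image modulo [B2]. By exactness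
   [a - a' = b + g u], where [u] lies in [P L'], hence in [P L]; so [a] is already in [L]. *)
have nPQ : ~ ((P L' `<=` P L)%classic /\ (Q L' `<=` Q L)%classic).
  case=> hP hQ; apply: nL'L => a L'a.
  have [|a' La' Ba'] := hQ (f a).
    by exists a => //; rewrite subrr; exact: sB2.1.
  have L'aa' : L' (a - a') by apply: submoduleB => //; exact: LL'.
  have [||b [u [Bb Au abu]]] := ex (a - a'); first exact: L'A.
    by rewrite linearB.
  have [|_ Lgu] := hP u.
    split=> //; have -> : g u = (a - a') - b by rewrite abu addrC addKr.
    by apply: submoduleB => //; exact/LL'/BL.
  rewrite -[a](subrK a') abu; apply: submoduleD => //; apply: submoduleD => //.
  exact: BL.
(* A trace that does not grow is equal to the old one, so its chain is kept; when both grow, the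
   inequality merely becomes slack. *)
have [hP|hP] := pselect (P L' `<=` P L)%classic.
  have hQ : ~ (Q L' `<=` Q L)%classic by move=> h; apply: nPQ.
  exists p, q.+1; split; first by rewrite addnS ltnS.
    by rewrite (_ : P L' = P L) //; apply/seteqP.
  by apply: ChainS cq _ _ _ _; [exact: subQ| | | exact: QA].
have cp' : chain_to A1 B1 p.+1 (P L').
  by apply: ChainS cp _ _ _ _; [exact: subP| | | move=> u []].
have [hQ|hQ] := pselect (Q L' `<=` Q L)%classic.
  exists p.+1, q; split; [by rewrite addSn ltnS | by [] |].
  by rewrite (_ : Q L' = Q L) //; apply/seteqP.
exists p.+1, q.+1; split=> //; first by rewrite addSn ltnS addnS ltnW.
by apply: ChainS cq _ _ _ _; [exact: subQ| | | exact: QA].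
Qed.

(** One inequality is the exactness of [0 -> A / B -> C / D], with [Z / Z] as the zero term; the
    other pulls chains back along [f]. *)
Lemma rlength_iso (U V : lmodType R) (f : {linear U -> V}) (A B : set U)
    (C D : set V) :
  submodule A -> submodule C -> submodule D ->
  (B `<=` A)%classic -> (D `<=` C)%classic ->
  (forall a, A a -> C (f a)) -> (forall c, C c -> exists2 a, A a & f a = c) ->
  (forall a, A a -> B a <-> D (f a)) ->
  rlength A B = rlength C D.
Proof.
move=> sA sC sD BA DC fA fs fB; apply/eqP; rewrite eq_le; apply/andP; split.
  pose Z : set U := fun u => u = 0.
  have sZ : submodule Z by split=> // a u v -> ->; rewrite scaler0 addr0.
  have B0 : B 0 by apply/fB; [exact: sA.1 | rewrite linear0; exact: sD.1].
  apply: (@le_trans _ _ (rlength Z Z + rlength C D)%E).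
    apply: (@rlength_exact U U V idfun f Z Z A B C D) => //; first by move=> _ ->.
    by move=> a Aa /fB Ba; exists a, 0; split; [exact: Ba | | rewrite addr0].
  rewrite -[leRHS]add0e; apply: leeD => //; exact: rlength0.
by apply: (rlength_surj (f := f)) => // b Bb; apply/fB => //; exact: BA.
Qed.

(** Translates between sequences of boolean predicates and inductive chains of sets; classical
    decidability turns a set back into a predicate. *)
Lemma mod_lengthE (V : lmodType R) :
  mod_length F V = rlength (@setT V) [set 0]%classic.
Proof.
rewrite /mod_length /rlength; congr ereal_sup; congr image.
apply/seteqP; split=> n /=.
  case=> N [sN cN].
  have sN' k : (k <= n)%N -> submodule (fun v => v \in N k).
    by move=> /sN [N0 NS]; split=> // a u v; apply: NS.
  exists (fun v => v \in N n); move: (leqnn n).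
  elim: {1 3 4}n => [|k IH] kn.
    by apply: Chain0 => //; [exact: sN' | move=> _ ->; exact: (sN' _ kn).1].
  apply: ChainS (IH (ltnW kn)) _ _ _ _ => //; first exact: sN'.
    by move=> v; exact: (cN _ kn).1.
  by move=> h; case: (cN _ kn) => _; apply.
case=> L c; suff [N [sN cN _]] : exists N : nat -> {pred V},
    [/\ forall k, (k <= n)%N -> submod_closed (N k), strict_chain n N &
        forall v, v \in N n <-> L v] by exists N.
have sE (M : set V) : submodule M -> submod_closed [pred v | `[< M v >]].
  move=> [M0 MS]; split; first exact/asboolP.
  by move=> a u v /asboolP Mu /asboolP Mv; apply/asboolP; exact: MS.
elim: c => {n L} [L sL _ _|n L L' _ [N [sN cN NL]] sL' LL' nL'L _].
  exists (fun=> [pred v | `[< L v >]] : {pred V}); split=> //; first by move=> k _; exact: sE.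
  by move=> v; split=> /asboolP.
(* Every index past [n] receives the new top [L']; only the index [n.+1] matters. *)
exists (fun k => if (k <= n)%N then N k else [pred v | `[< L' v >]] : {pred V}).
split=> [k _|k|v].
- by case: ifPn => [/sN//|_]; exact: sE.
- rewrite ltnS leq_eqVlt => /predU1P[->|kn].
    rewrite eqxx ltnn /=; split=> [v /NL /LL' h|h]; first exact/asboolP.
    by apply: nL'L => v L'v; apply/NL/h/asboolP.
  by rewrite kn orbT; exact: cN.
- by rewrite ltnn; split=> /asboolP.
Qed.

End RelativeLength.

(** * Contraction and exterior multiplication on the Koszul complex *)

Section Exterior.
Variables (R : comNzRingType) (n : nat) (M : lmodType R).
Implicit Types (phi : koszul n M) (s t : 'I_n) (S T A B : {set 'I_n}).

Lemma koszul_signD1 T s t : s \in T ->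
  koszul_sign R (T :\ s) t = (-1) ^+ (s < t)%N * koszul_sign R T t.
Proof.
move=> sT; rewrite -{2}(finset.setD1K sT) koszul_signU1 ?finset.setD11 //.
by rewrite mulrA -expr2 sqrr_sign mul1r.
Qed.

Lemma koszul_sign_sqr T s : koszul_sign R T s * koszul_sign R T s = 1.
Proof. by rewrite -expr2 /koszul_sign exprAC sqrrN expr1n expr1n. Qed.

(** Interior product with the dual basis vector of [e_s]; the Koszul differential is the combination
    of these with coefficients [x s]. *)
Definition contraction s phi : koszul n M :=
  [ffun T : {set 'I_n} =>
    if s \in T then 0 else koszul_sign R T s *: phi (s |: T)].

(** Left multiplication by [e_s] in the exterior algebra. *)
Definition wedge s phi : koszul n M :=
  [ffun T : {set 'I_n} =>
    if s \in T then koszul_sign R T s *: phi (T :\ s) else 0].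

Fact contraction_is_linear s : linear (contraction s).
Proof.
move=> a u v; apply/ffunP => T; rewrite !ffunE.
case: ifP => _; first by rewrite scaler0 addr0.
by rewrite scalerDr !scalerA mulrC.
Qed.

HB.instance Definition _ s := GRing.isLinear.Build R (koszul n M) (koszul n M) _
  (contraction s) (contraction_is_linear s).

Fact wedge_is_linear s : linear (wedge s).
Proof.
move=> a u v; apply/ffunP => T; rewrite !ffunE.
case: ifP => _; last by rewrite scaler0 addr0.
by rewrite scalerDr !scalerA mulrC.
Qed.

HB.instance Definition _ s := GRing.isLinear.Build R (koszul n M) (koszul n M) _
  (wedge s) (wedge_is_linear s).

Lemma koszul_diffE x phi :
  koszul_diff x phi = \sum_s x s *: contraction s phi.
Proof.
apply/ffunP => T; rewrite ffunE sum_ffunE big_mkcond /=.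
apply: eq_bigr => s _; rewrite !ffunE; case: (s \in T) => /=.
  by rewrite scaler0.
by rewrite scalerA mulrC.
Qed.

(** A Clifford relation. At each [T] a single term survives, the first if [s] is outside [T] and the
    second if it is inside, and its sign occurs squared. *)
Lemma contraction_wedge_same s phi :
  contraction s (wedge s phi) + wedge s (contraction s phi) = phi.
Proof.
apply/ffunP => T; rewrite !ffunE finset.setU11 finset.setD11; case: ifP => sT.
  by rewrite finset.setD1K // add0r scalerA koszul_signD1 // ltnn mul1r
    koszul_sign_sqr scale1r.
rewrite addr0 finset.setU1K ?sT // scalerA koszul_signU1 ?sT // ltnn mul1r.
by rewrite koszul_sign_sqr scale1r.
Qed.

(** Exactly one of [s < t] and [t < s] holds; all the anticommutation below comes from this. *)
Lemma sign_ltn_neq s t : s != t ->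
  (-1) ^+ (s < t)%N = - (-1) ^+ (t < s)%N :> R.
Proof.
by move=> st; case: ltngtP => [||/val_inj/eqP]; rewrite ?expr0 ?expr1 ?opprK //
  (negbTE st).
Qed.

Lemma contraction_wedge s t phi : s != t ->
  contraction t (wedge s phi) = - wedge s (contraction t phi).
Proof.
move=> st; apply/ffunP => T; rewrite !ffunE !inE (negbTE st) eq_sym (negbTE st) /=.
case: ifP => tT; case: ifP => sT; rewrite ?scaler0 ?oppr0 //.
have -> : (t |: T) :\ s = t |: (T :\ s).
  by apply/setP => u; rewrite !inE; have [->|] := eqVneq u s; rewrite ?(negbTE st).
rewrite !scalerA -scaleNr; congr (_ *: _).
rewrite koszul_signU1 ?tT // koszul_signD1 // [in LHS]sign_ltn_neq 1?eq_sym //.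
by rewrite mulNr mulrN mulrCA [in RHS]mulrCA [X in - (_ * X)]mulrC.
Qed.

Lemma contractionC s t phi :
  contraction s (contraction t phi) = - contraction t (contraction s phi).
Proof.
apply/ffunP => T; rewrite !ffunE !inE.
have [->|st] := eqVneq s t; first by rewrite /= scaler0 if_same oppr0.
rewrite /=.
case: ifP => sT; case: ifP => tT; rewrite ?scaler0 ?oppr0 //.
rewrite finset.setUCA !scalerA -scaleNr; congr (_ *: _).
rewrite !koszul_signU1 ?sT ?tT // [in LHS]sign_ltn_neq //.
by rewrite mulNr mulrN mulrCA [in RHS]mulrCA [X in - (_ * X)]mulrC.
Qed.

(** Contractions anticommute with one another, hence with their combination [koszul_diff]. Up to
    sign, contraction is thus a chain map of degree [-1]. *)
Lemma koszul_diff_contraction x s phi :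
  koszul_diff x (contraction s phi) = - contraction s (koszul_diff x phi).
Proof.
rewrite !koszul_diffE linear_sum -sumrN; apply: eq_bigr => t _.
by rewrite linearZ /= contractionC scalerN.
Qed.

(** Among the terms of the differential, the one of index [s] yields [x s *: phi] by the Clifford
    relation, and all others anticommute with [wedge s]. *)
Lemma koszul_diff_wedge x s phi :
  koszul_diff x (wedge s phi) = x s *: phi - wedge s (koszul_diff x phi).
Proof.
rewrite !koszul_diffE linear_sum (bigD1 s) //=.
rewrite [in RHS](bigD1 s) //= opprD addrA.
congr (_ + _).
  by rewrite linearZ /= -scalerBr -[X in X - _](contraction_wedge_same s) addrK.
rewrite -sumrN; apply: eq_bigr => t ts.
by rewrite contraction_wedge 1?eq_sym // linearZ /= scalerN.
Qed.

(* Degree [p] of [K(x_s, s \in A; M)], viewed inside [K(x; M)]. *)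
Definition koszul_part A (p : nat) : set (koszul n M) :=
  fun phi => forall S, ~~ ((S \subset A) && (#|S| == p)) -> phi S = 0.

Lemma koszul_part_submodule A p : submodule (koszul_part A p).
Proof.
split=> [S _|a u v hu hv S hS]; first by rewrite ffunE.
by rewrite !ffunE hu // hv // scaler0 addr0.
Qed.

Lemma koszul_part_sum A p (I : Type) (r : seq I) (P : pred I) G :
  (forall i, P i -> koszul_part A p (G i)) ->
  koszul_part A p (\sum_(i <- r | P i) G i).
Proof.
move=> h; apply: big_ind h; first exact: submodule0 (koszul_part_submodule A p).
by move=> u v; apply: submoduleD; exact: koszul_part_submodule.
Qed.

Lemma koszul_part_contraction A p s phi : koszul_part A p.+1 phi ->
  koszul_part (A :\ s) p (contraction s phi).
Proof.
move=> h S; rewrite ffunE; case: ifPn => // sS hS; rewrite h ?scaler0 //.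
apply: contra hS => /andP[SA]; rewrite cardsU1 sS add1n eqSS => ->.
rewrite andbT finset.subsetD1 sS andbT; exact: fintype.subset_trans (finset.subsetUr _ _) SA.
Qed.

Lemma koszul_part_subset A B p phi : A \subset B ->
  koszul_part A p phi -> koszul_part B p phi.
Proof.
move=> AB h S hS; apply: h; apply: contra hS => /andP[SA ->].
by rewrite (fintype.subset_trans SA AB).
Qed.

Lemma koszul_part_wedge A p s phi : koszul_part A p phi ->
  koszul_part (s |: A) p.+1 (wedge s phi).
Proof.
move=> h S; rewrite ffunE; case: ifPn => // sS hS; rewrite h ?scaler0 //.
apply: contra hS; rewrite finset.subDset => /andP[-> /eqP <-].
by rewrite [#|S|](cardsD1 s) sS add1n eqxx.
Qed.

Lemma koszul_part_diff x A p phi : koszul_part A p.+1 phi ->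
  koszul_part A p (koszul_diff x phi).
Proof.
move=> h; rewrite koszul_diffE; apply: koszul_part_sum => s _.
apply: (submoduleZ (@koszul_part_submodule A p)).
apply: (@koszul_part_subset (A :\ s)); first exact: finset.subD1set.
exact: koszul_part_contraction.
Qed.

Lemma contraction_notin A p s phi : s \notin A -> koszul_part A p phi ->
  contraction s phi = 0.
Proof.
move=> sA h; apply/ffunP => S; rewrite !ffunE; case: ifP => // _.
rewrite h ?scaler0 // finset.subUset finset.sub1set (negbTE sA) //.
Qed.

(** For [s] outside [A], [wedge s] is a section of the contraction from the part on [s |: A] to the
    part on [A]. *)
Lemma contraction_wedgeK A p s phi : s \notin A -> koszul_part A p phi ->
  contraction s (wedge s phi) = phi.
Proof.
move=> sA h; rewrite -[RHS](contraction_wedge_same s).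
by rewrite (contraction_notin sA h) linear0 addr0.
Qed.

(** If [s] is in [S], the coefficient at [S] is, up to a sign, that of the contraction at [S :\ s].
    So the kernel of contraction on the part over [s |: A] is the part over [A]. *)
Lemma koszul_part_contraction0 A p s phi : koszul_part (s |: A) p phi ->
  contraction s phi = 0 -> koszul_part A p phi.
Proof.
move=> h c0 S hS; have [sS|sS] := boolP (s \in S); last first.
  apply: h; apply: contra hS => /andP[SA ->]; rewrite andbT.
  apply/fintype.subsetP => t tS; have := fintype.subsetP SA t tS.
  by rewrite !inE => /orP[/eqP ts|//]; rewrite -ts tS in sS.
move/ffunP/(_ (S :\ s)): c0; rewrite !ffunE finset.setD11 finset.setD1K //.
move=> /(congr1 (fun m => koszul_sign R (S :\ s) s *: m)).
by rewrite scalerA koszul_sign_sqr scale1r scaler0.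
Qed.

Variable x : 'I_n -> R.

Definition part_cycle A p : set (koszul n M) :=
  fun phi => koszul_part A p phi /\ koszul_diff x phi = 0.

Definition part_boundary A p : set (koszul n M) :=
  fun phi => exists2 w, koszul_part A p.+1 w & phi = koszul_diff x w.

Lemma part_cycle_submodule A p : submodule (part_cycle A p).
Proof.
split; first by split; [exact: submodule0 (koszul_part_submodule _ _)|exact: linear0].
move=> a u v [hu du] [hv dv]; split; first exact: (koszul_part_submodule A p).2.
by rewrite linearP /= du dv scaler0 addr0.
Qed.

Lemma part_boundary_submodule A p : submodule (part_boundary A p).
Proof.
split.
  exists 0; first exact: submodule0 (koszul_part_submodule _ _).
  by rewrite linear0.
move=> a u v [w hw ->] [w' hw' ->]; exists (a *: w + w'); last by rewrite linearP.
exact: (koszul_part_submodule A p.+1).2.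
Qed.

Lemma part_boundary_cycle A p : (part_boundary A p `<=` part_cycle A p)%classic.
Proof.
by move=> _ [w hw ->]; split; [exact: koszul_part_diff | exact: koszul_diffK].
Qed.

End Exterior.

(** * Lengths of Koszul homology when elements are adjoined or removed *)

Section PartLength.
Variables (F : realType) (R : comNzRingType) (n : nat) (M : lmodType R).
Variable x : 'I_n -> R.
Implicit Types (A B : {set 'I_n}) (s : 'I_n).

Definition part_length A (p : nat) : \bar F :=
  rlength F (@part_cycle R n M x A p) (part_boundary x A p).

Lemma part_length_ge0 A p : (0 <= part_length A p)%E.
Proof.
apply: rlength_ge0; [exact: part_cycle_submodule | exact: part_boundary_cycle].
Qed.

Lemma part_length_gt_card A p : (#|A| < p)%N -> part_length A p = 0%E.
Proof.
move=> Ap; apply/eqP; rewrite eq_le part_length_ge0 andbT.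
apply: rlength0 => phi [h _]; suff -> : phi = 0.
  exact: submodule0 (part_boundary_submodule _ _ _ _).
apply/ffunP => S; rewrite ffunE h //; apply/negP => /andP[/subset_leq_card].
by move=> SA /eqP Sp; rewrite Sp leqNgt Ap in SA.
Qed.

(** Middle exactness of [H_{p+1}(A) -> H_{p+1}(s |: A) -> H_p(A)], the maps being inclusion and
    contraction. *)
Lemma part_length_setU1_le A s p : s \notin A ->
  (part_length (s |: A) p.+1 <= part_length A p.+1 + part_length A p)%E.
Proof.
move=> sA; have AsA : A \subset s |: A by exact: finset.subsetUr.
have sAK : (s |: A) :\ s = A by rewrite finset.setU1K.
apply: (@rlength_exact F R (koszul n M) (koszul n M) (koszul n M)
  idfun (contraction s)).
- exact: part_cycle_submodule.
- exact: part_cycle_submodule.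
- exact: part_boundary_submodule.
- exact: part_boundary_cycle.
- exact: part_boundary_cycle.
- move=> _ [w hw ->]; exists w => //; exact: koszul_part_subset hw.
- move=> a [ha da]; split; first by rewrite -sAK; exact: koszul_part_contraction.
  by rewrite koszul_diff_contraction da linear0 oppr0.
move=> a [ha da] [v hv av].
(* The contraction of [a] is the boundary of [v]. Since contraction anticommutes with the
   differential, subtracting [b] from [a] cancels it, and [a - b] is a cycle supported on [A]. *)
pose b := - koszul_diff x (wedge s v).
exists b, (a - b); split; last by rewrite /= addrC subrK.
  exists (- wedge s v); last by rewrite linearN.
  rewrite -scaleN1r; apply: (submoduleZ (@koszul_part_submodule _ _ _ _ _)).
  exact: koszul_part_wedge.
have dab : koszul_diff x (a - b) = 0.
  by rewrite /b opprK linearD /= da koszul_diffK addr0.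
split=> //; apply: (@koszul_part_contraction0 _ _ _ A p.+1 s).
  rewrite /b opprK; apply: (submoduleD (@koszul_part_submodule _ _ _ _ _)) => //.
  apply: koszul_part_diff; exact: koszul_part_wedge.
rewrite /b opprK linearD /= av -[X in _ + X]opprK -koszul_diff_contraction.
by rewrite (contraction_wedgeK sA hv) subrr.
Qed.

(** Modulo boundaries, this is the annihilator of [a] in [H_p(A)]. *)
Definition colon_cycle A p (a : R) : set (koszul n M) :=
  fun v => part_cycle x A p v /\ part_boundary x A p (a *: v).

Lemma colon_cycle_submodule A p a : submodule (colon_cycle A p a).
Proof.
split.
  split; first exact: submodule0 (part_cycle_submodule _ _ _ _).
  by rewrite scaler0; exact: submodule0 (part_boundary_submodule _ _ _ _).
move=> b u v [hu du] [hv dv]; split; first exact: (part_cycle_submodule M x A p).2.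
rewrite scalerDr scalerA mulrC -scalerA.
exact: (part_boundary_submodule M x A p).2.
Qed.

Lemma boundary_colon_cycle A p a :
  (part_boundary x A p `<=` colon_cycle A p a)%classic.
Proof.
move=> v hv; split; first exact: part_boundary_cycle.
exact: (submoduleZ (part_boundary_submodule M x A p)).
Qed.

(** Multiplication by [a] gives an exact sequence [0 -> (0 : a) -> (0 : a^(k+1)) -> (0 : a^k)] in
    homology, so each power adds at most one copy of the length of [(0 : a)]. *)
Lemma colon_cycle_expr_le A p (a : R) (k : nat) :
  (rlength F (colon_cycle A p (a ^+ k)) (part_boundary x A p)
   <= (k%:R : F)%:E * rlength F (colon_cycle A p a) (part_boundary x A p))%E.
Proof.
elim: k => [|k IH].
  (* Here [0 * +oo = 0], so the bound is [0] even for an infinite length; only boundaries are killed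
     by [1]. *)
  by rewrite mul0e; apply: rlength0 => v [_]; rewrite expr0 scale1r.
rewrite -natr1 EFinD ge0_muleDl ?lee_fin // mul1e addeC.
apply: le_trans (leeD (le_refl _) IH).
apply: (@rlength_exact F R (koszul n M) (koszul n M) (koszul n M)
  idfun (GRing.scale a)).
- exact: colon_cycle_submodule.
- exact: colon_cycle_submodule.
- exact: part_boundary_submodule.
- exact: boundary_colon_cycle.
- exact: boundary_colon_cycle.
- by [].
- move=> v [hv dv]; split; first exact: (submoduleZ (part_cycle_submodule M x A p)).
  by rewrite /= scalerA -exprSr.
- move=> v [hv _] av; exists 0, v; split; [|by split|by rewrite add0r].
  exact: submodule0 (part_boundary_submodule _ _ _ _).
Qed.

Lemma colon_cycle_le_setU1 A s p : s \notin A ->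
  (rlength F (colon_cycle A p (x s)) (part_boundary x A p)
   <= part_length (s |: A) p.+1)%E.
Proof.
move=> sA; have sAK : (s |: A) :\ s = A by rewrite finset.setU1K.
apply: (@rlength_surj F R (koszul n M) (koszul n M) (contraction s)).
- exact: part_cycle_submodule.
- exact: part_boundary_cycle.
- move=> _ [w hw ->]; exists (- contraction s w).
    rewrite -scaleN1r; apply: (submoduleZ (@koszul_part_submodule _ _ _ _ _)).
    by rewrite -sAK; exact: koszul_part_contraction.
  by rewrite linearN /= koszul_diff_contraction opprK.
(* With [x s *: v] the boundary of [u], the homotopy formula makes [wedge s v - u] a cycle, and its
   contraction is [v]. *)
move=> v [[hv dv] [u hu xvu]]; exists (wedge s v - u); last first.
  by rewrite linearB /= (contraction_wedgeK sA hv) (contraction_notin sA hu) subr0.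
split.
  apply: (submoduleB (@koszul_part_submodule _ _ _ _ _)).
    exact: koszul_part_wedge.
  exact: koszul_part_subset (finset.subsetUr _ _) hu.
by rewrite linearB /= koszul_diff_wedge dv linear0 subr0 xvu subrr.
Qed.

(* [wedge t] is a homotopy between multiplication by [x t] and [0]. *)
Lemma part_cycle_boundaryZ A p (c : 'I_n -> R) (v : koszul n M) :
  part_cycle x A p v ->
  part_boundary x A p ((\sum_(t in A) c t * x t) *: v).
Proof.
move=> [hv dv]; exists (\sum_(t in A) c t *: wedge t v).
  apply: koszul_part_sum => t tA; apply: (submoduleZ (@koszul_part_submodule _ _ _ _ _)).
  have -> : A = t |: A by apply/esym/finset.setUidPr; rewrite finset.sub1set.
  exact: koszul_part_wedge.
rewrite linear_sum scaler_suml; apply: eq_bigr => t _.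
by rewrite linearZ /= koszul_diff_wedge dv linear0 subr0 scalerA.
Qed.

(** The power [x s ^+ k] lies in the ideal generated by the [x t], [t] in [A], and so kills
    [H_p(A)]: every cycle belongs to [colon_cycle A p (x s ^+ k)]. *)
Lemma part_length_le_setU1 A s p (k : nat) (c : 'I_n -> R) : s \notin A ->
  x s ^+ k = \sum_(t in A) c t * x t ->
  (part_length A p <= (k%:R : F)%:E * part_length (s |: A) p.+1)%E.
Proof.
move=> sA xk; apply: (@le_trans _ _ ((k%:R : F)%:E *
  rlength F (colon_cycle A p (x s)) (part_boundary x A p))%E); last first.
  by apply: lee_wpmul2l; [rewrite lee_fin | exact: colon_cycle_le_setU1].
apply: le_trans (colon_cycle_expr_le _ _ _ _).
rewrite /part_length (_ : part_cycle x A p = colon_cycle A p (x s ^+ k)) //.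
apply/seteqP; split=> v; last by case.
by move=> hv; split=> //; rewrite xk; exact: part_cycle_boundaryZ.
Qed.

Lemma part_length_le_setU A B p (k : nat) : [disjoint A & B] ->
  (forall s, s \in B -> exists c : 'I_n -> R,
     x s ^+ k = \sum_(t in A) c t * x t) ->
  (part_length A p <= ((k ^ #|B|)%:R : F)%:E
     * part_length (A :|: B) (p + #|B|))%E.
Proof.
move=> dAB hB.
(* The elements of [B] are adjoined one at a time, each costing a factor [k] and raising the degree
   by one. *)
have sAB : forall C : {set 'I_n}, C \subset B -> (part_length A p <=
    ((k ^ #|C|)%:R : F)%:E * part_length (C :|: A) (p + #|C|))%E.
  move=> C; have [e] := ubnP #|C|; elim: e C => // e IH C Ce CB.
  have [->|[s sC]] := set_0Vmem C.
    by rewrite cards0 expn0 mul1e addn0 finset.set0U.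
  have sB : s \in B by exact: (fintype.subsetP CB).
  have sA : s \notin A by rewrite (disjointFl dAB sB).
  have [c xk] := hB s sB.
  have CE : #|C| = #|C :\ s|.+1 by rewrite (cardsD1 s) sC.
  apply: le_trans (IH (C :\ s) _ _) _.
  - by rewrite CE ltnS in Ce.
  - exact: fintype.subset_trans (finset.subD1set _ _) CB.
  rewrite CE expnSr natrM EFinM -muleA addnS.
  rewrite (_ : C :|: A = s |: ((C :\ s) :|: A)); last first.
    by rewrite finset.setUA finset.setD1K.
  apply: lee_wpmul2l; first by rewrite lee_fin.
  (* The relation over [A] is extended by zero to the elements already adjoined. *)
  apply: (@part_length_le_setU1 _ _ _ _ (fun t => if t \in A then c t else 0)).
    by rewrite finset.in_setU finset.setD11 (negbTE sA).
  rewrite xk (bigID (mem A) (fun t => t \in (C :\ s) :|: A)) /=.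
  rewrite [X in _ + X]big1 ?addr0; last first.
    by move=> t /andP[_ /negbTE ->]; rewrite mul0r.
  by apply: eq_big => t; [rewrite !inE; case: (t \in A); rewrite ?orbT ?andbF|move=> ->].
by rewrite finset.setUC; exact: sAB.
Qed.

(** Removing one element of [B] bounds each length by two lengths in adjacent degrees, so the tail
    sum at most doubles after a shift by one. The bound on [#|A|] makes the term that enters at the
    top vanish. *)
Lemma part_sigma_setU_le A B i N : [disjoint A & B] -> (#|A| <= N)%N ->
  (\sum_(i + #|B| <= j < (N + #|B|).+1) part_length (A :|: B) j
   <= ((2 ^ #|B|)%:R : F)%:E * \sum_(i <= j < N.+1) part_length A j)%E.
Proof.
move=> dAB AN; have [e] := ubnP #|B|; elim: e B dAB => // e IH B dAB Be.
have [->|[s sB]] := set_0Vmem B.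
  by rewrite cards0 expn0 mul1e !addn0 finset.setU0.
have BE : #|B| = #|B :\ s|.+1 by rewrite (cardsD1 s) sB.
have sA : s \notin A by rewrite (disjointFl dAB sB).
have dAB' : [disjoint A & B :\ s].
  by apply: disjointWr dAB; exact: finset.subD1set.
have Bs : (#|B :\ s| < e)%N by rewrite BE ltnS in Be.
have {IH} := IH _ dAB' Bs; rewrite {1 2 3}BE; set C := B :\ s => IH.
rewrite expnS natrM EFinM -muleA.
apply: le_trans (lee_wpmul2l _ IH); last by rewrite lee_fin.
rewrite !addnS big_add1 /=.
have ABE : A :|: B = s |: (A :|: C) by rewrite finset.setUCA finset.setD1K.
rewrite ABE; set D := A :|: C.
have sD : s \notin D by rewrite finset.in_setU finset.setD11 (negbTE sA).
have le2 : (\sum_(i + #|C| <= j < (N + #|C|).+1) part_length (s |: D) j.+1 <=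
   \sum_(i + #|C| <= j < (N + #|C|).+1) (part_length D j.+1 + part_length D j))%E.
  by apply: lee_sum => j _; exact: part_length_setU1_le.
apply: le_trans le2 _; rewrite big_split /= (_ : (2%:R : F) = 1 + 1) //.
rewrite EFinD ge0_muleDl ?lee_fin // !mul1e; apply: leeD => //.
have [iN|Ni] := leqP (i + #|C|) (N + #|C|); last first.
  by rewrite !big_geq.
(* The shifted sum loses its lowest term and gains the one in degree [(N + #|C|).+1], which exceeds
   [#|D|]. *)
rewrite [leRHS]big_nat_recl // big_nat_recr //=.
have -> : part_length D (N + #|C|).+1 = 0%E.
  apply: part_length_gt_card; rewrite ltnS.
  by apply: leq_trans (leq_card_setU _ _) _; rewrite leq_add2r.
rewrite adde0 -[leLHS]add0e; apply: leeD => //; exact: part_length_ge0.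
Qed.

End PartLength.

(** * Length of a quotient module as a relative length *)

Section QuotientLength.
Variables (R : pzRingType) (V : lmodType R) (B : {pred V}).
Variable hB : submod_closed B.

Definition quot_pi (v : V) : quot_mod hB := (\pi_(quot_mod hB) v)%qT.

Fact quot_pi_is_linear : linear quot_pi.
Proof. by move=> a u v; rewrite /quot_pi pi_quot_modD -quot_scale_pi. Qed.

HB.instance Definition _ :=
  GRing.isLinear.Build R V (quot_mod hB) _ quot_pi quot_pi_is_linear.

Lemma quot_pi_eq0 v : (quot_pi v == 0) = (v \in B).
Proof.
rewrite -[0](linear0 quot_pi) /quot_pi -Quotient.idealrBE subr0.
by [].
Qed.

Lemma mod_length_quot (F : realType) :
  mod_length F (quot_mod hB) = rlength F (@setT V) (fun v => v \in B).
Proof.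
rewrite mod_lengthE; apply/esym.
apply: (@rlength_iso F R V (quot_mod hB) quot_pi) => //.
- by split=> // a u v -> ->; rewrite scaler0 addr0.
- by move=> c _; exists (repr c) => //; exact: reprK.
- by move=> v _; rewrite /= -quot_pi_eq0; split=> [/eqP|->].
Qed.

End QuotientLength.

(** * The Koszul complex of a subsequence as a part of the larger complex *)

Section KoszulLength.
Variables (F : realType) (R : comNzRingType) (n m : nat) (M : lmodType R).
Variables (z : 'I_m -> R) (f : 'I_n -> 'I_m).
Hypothesis f_mono : {mono f : i j / (i < j)%N}.

Let f_inj : injective f.
Proof.
move=> i j fij; apply/val_inj; case: (ltngtP i j) => //.
  by rewrite -f_mono fij ltnn.
by rewrite -f_mono fij ltnn.
Qed.

Let imf : {set 'I_m} := (f @: [set: 'I_n]).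

(** The map sending [v e_T] to [v e_(f @: T)]. *)
Definition koszul_extend (phi : koszul n M) : koszul m M :=
  [ffun S : {set 'I_m} => if S \subset imf then phi (f @^-1: S) else 0].

Fact koszul_extend_is_linear : linear koszul_extend.
Proof.
move=> a u v; apply/ffunP => S; rewrite !ffunE; case: ifP => // _.
by rewrite scaler0 addr0.
Qed.

HB.instance Definition _ := GRing.isLinear.Build R (koszul n M) (koszul m M) _
  koszul_extend koszul_extend_is_linear.

Lemma preimset_imset (T : {set 'I_n}) : f @^-1: (f @: T) = T.
Proof. by apply/setP => i; rewrite inE mem_imset. Qed.

Lemma imset_preimset (S : {set 'I_m}) : S \subset imf -> f @: (f @^-1: S) = S.
Proof.
move=> Sf; apply/setP => j; apply/imsetP/idP => [[i]|jS].
  by rewrite inE => iS ->.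
have /imsetP[i _ ji] := fintype.subsetP Sf _ jS.
by exists i => //; rewrite inE -ji.
Qed.

Lemma imset_sub (T : {set 'I_n}) : f @: T \subset imf.
Proof. by apply: imsetS; apply/fintype.subsetP. Qed.

Lemma koszul_extendE phi (T : {set 'I_n}) : koszul_extend phi (f @: T) = phi T.
Proof. by rewrite ffunE imset_sub preimset_imset. Qed.

Lemma koszul_extend_inj : injective koszul_extend.
Proof.
by move=> u v uv; apply/ffunP => T; rewrite -!koszul_extendE uv.
Qed.

(** The sign counts the members of [T] below [i], and an order-preserving [f] keeps this count. *)
Lemma koszul_sign_imset (T : {set 'I_n}) i :
  koszul_sign R (f @: T) (f i) = koszul_sign R T i.
Proof.
rewrite /koszul_sign; congr (_ ^+ _).
rewrite -(card_imset _ f_inj); apply: eq_card => j; rewrite !inE.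
apply/andP/imsetP => [[/imsetP[k kT ->]]|[k]].
  by rewrite f_mono => ki; exists k => //; rewrite inE kT.
by rewrite inE => /andP[kT ki] ->; rewrite f_mono mem_imset.
Qed.

(** At [S] inside the image of [f], an index [s] outside that image contributes zero, since [s |: S]
    leaves the image; the remaining indices are reindexed along [f]. *)
Lemma koszul_diff_extend phi :
  koszul_diff z (koszul_extend phi) = koszul_extend (koszul_diff (z \o f) phi).
Proof.
apply/ffunP => S; rewrite ffunE [RHS]ffunE; case: ifPn => Sf; last first.
  apply: big1 => s _; rewrite ffunE ifN ?scaler0 //.
  by apply: contra Sf; apply: fintype.subset_trans; exact: finset.subsetUr.
rewrite ffunE (bigID (mem imf)) /= [X in _ + X]big1 ?addr0; last first.
  move=> s /andP[_ sf]; rewrite ffunE ifN ?scaler0 //.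
  by rewrite finset.subUset finset.sub1set (negbTE sf).
rewrite -{2 3}(imset_preimset Sf); set T := f @^-1: S.
rewrite (eq_bigl (fun s => s \in f @: ~: T)); last first.
  move=> s; apply/andP/imsetP => [[sT /imsetP[i _ si]]|[i iT ->]].
    by exists i => //; rewrite !inE -si.
  by split; [move: iT; rewrite /T !inE | exact: imset_f].
rewrite big_imset /=; last by move=> i j _ _; exact: f_inj.
apply: eq_big => [i|i _]; first by rewrite inE.
by rewrite koszul_sign_imset -imsetU1 koszul_extendE.
Qed.

Lemma koszul_part_extend p phi :
  koszul_part [set: 'I_n] p phi <-> koszul_part imf p (koszul_extend phi).
Proof.
split=> h S hS.
  rewrite ffunE; case: ifP => // Sf; rewrite h //.
  apply: contra hS => /andP[_ /eqP <-]; rewrite Sf /=.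
  by rewrite -{1}(imset_preimset Sf) card_imset.
rewrite -koszul_extendE h // imset_sub card_imset //=.
by move: hS; rewrite finset.subsetT.
Qed.

Lemma koszul_extend_surj p psi : koszul_part imf p psi ->
  exists2 phi, koszul_part [set: 'I_n] p phi & koszul_extend phi = psi.
Proof.
move=> h; pose phi : koszul n M := [ffun T : {set 'I_n} => psi (f @: T)].
have E : koszul_extend phi = psi.
  apply/ffunP => S; rewrite ffunE; case: ifPn => Sf.
    by rewrite ffunE imset_preimset.
  by rewrite h // (negbTE Sf).
by exists phi => //; apply/koszul_part_extend; rewrite E.
Qed.

Lemma part_length_extend p :
  part_length F M (z \o f) [set: 'I_n] p = part_length F M z imf p.
Proof.
apply: (@rlength_iso F R (koszul n M) (koszul m M) koszul_extend).
- exact: part_cycle_submodule.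
- exact: part_cycle_submodule.
- exact: part_boundary_submodule.
- exact: part_boundary_cycle.
- exact: part_boundary_cycle.
- move=> a [/koszul_part_extend ha da]; split=> //.
  by rewrite koszul_diff_extend da linear0.
- move=> _ [/koszul_extend_surj[phi hphi <-] dc]; exists phi => //; split=> //.
  by apply: koszul_extend_inj; rewrite -koszul_diff_extend dc linear0.
move=> a _; split=> [[w hw ->]|[w' /koszul_extend_surj[w hw <-] aw]].
  exists (koszul_extend w); first exact/koszul_part_extend.
  by rewrite koszul_diff_extend.
by exists w => //; apply: koszul_extend_inj; rewrite aw koszul_diff_extend.
Qed.

Lemma koszul_homog_part p (phi : koszul n M) :
  phi \in @koszul_homog R n M p <-> koszul_part [set: 'I_n] p phi.
Proof.
split=> [/koszul_homogP h S|h].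
  by rewrite finset.subsetT; exact: h.
by apply/koszul_homogP => S hS; apply: h; rewrite negb_and hS orbT.
Qed.

(** [val] identifies the subtype of cycles with [part_cycle] over all indices, and its boundaries
    with [part_boundary]. *)
Lemma koszul_length_part (p : nat) :
  koszul_length F (z \o f) M p = part_length F M z imf p.
Proof.
rewrite -part_length_extend /koszul_length /koszul_homology mod_length_quot.
apply: (@rlength_iso F R (koszul_cycles (z \o f) M p) (koszul n M) val) => //.
- exact: part_cycle_submodule.
- exact: part_boundary_submodule.
- exact: part_boundary_cycle.
- move=> v _; have /andP[/koszul_homog_part hv /eqP dv] := valP v.
  by split.
- move=> c [/koszul_homog_part hc /eqP dc].
  have cP : c \in @koszul_cycle R n (z \o f) M p by apply/andP.
  by exists (Sub c cP) => //; rewrite SubK.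
- move=> v _; split=> [/asboolP[w /koszul_homog_part hw vw]|[w hw vw]].
    by exists w.
  by apply/asboolP; exists w => //; exact/koszul_homog_part.
Qed.

End KoszulLength.

(** * Comparison of two sequences and of two systems of parameters *)

Lemma koszul_sigma_le (F : realType) (R : comNzRingType) (d : nat)
    (x y : 'I_d -> R) (k : nat) (M : lmodType R) (i : nat) :
  (forall s : 'I_d, lspan (y : 'I_d -> R^o) (x s ^+ k : R^o)) ->
  (koszul_sigma F y M i
   <= ((k ^ d * 2 ^ d)%:R : F)%:E * koszul_sigma F x M i)%E.
Proof.
move=> hxy.
(* The concatenation of [x] and [y], which are recovered along the monotone maps [lshift] and
   [rshift]; [X] and [Y] are the two blocks of indices. *)
pose z (j : 'I_(d + d)) := match split j with inl s => x s | inr s => y s end.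
have zl : x = z \o @lshift d d.
  by apply/funext => s; rewrite /z /= (unsplitK (inl s : 'I_d + 'I_d)).
have zr : y = z \o @rshift d d.
  by apply/funext => s; rewrite /z /= (unsplitK (inr s : 'I_d + 'I_d)).
pose X := @lshift d d @: [set: 'I_d]; pose Y := @rshift d d @: [set: 'I_d].
have XE j : koszul_length F x M j = part_length F M z X j.
  by rewrite [in LHS]zl koszul_length_part.
have YE j : koszul_length F y M j = part_length F M z Y j.
  by rewrite [in LHS]zr koszul_length_part // => s t /=; rewrite ltn_add2l.
have cX : #|X| = d by rewrite card_imset ?cardsT ?card_ord //; exact: lshift_inj.
have cY : #|Y| = d by rewrite card_imset ?cardsT ?card_ord //; exact: rshift_inj.
have dXY : [disjoint X & Y].
  apply/pred0P => j /=; apply/negP => /andP[/imsetP[s _ ->] /imsetP[t _] /eqP].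
  by rewrite eq_lrshift.
have hX s : s \in X -> exists c : 'I_(d + d) -> R,
    z s ^+ k = \sum_(t in Y) c t * z t.
  move=> /imsetP[s' _ ->]; have [c xc] := hxy s'.
  exists (fun j => match split j with inl _ => 0 | inr t => c t end).
  rewrite big_imset /=; last by move=> u v _ _; exact: rshift_inj.
  rewrite [z _](_ : _ = x s'); last by rewrite zl.
  rewrite xc; apply: eq_big => [t|t _]; first by rewrite inE.
  by rewrite {1}zr /= (unsplitK (inr t : 'I_d + 'I_d)).
rewrite /koszul_sigma (eq_bigr _ (fun j _ => XE j)) (eq_bigr _ (fun j _ => YE j)).
(* Adjoining the [d] indices of [X] to [Y] shifts the degree by [d] and costs [k ^ d]; removing [Y]
   afterwards costs [2 ^ d] and undoes the shift. *)
apply: (@le_trans _ _ (\sum_(i <= j < d.+1)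
    ((k ^ d)%:R : F)%:E * part_length F M z (X :|: Y) (j + d)))%E.
  apply: lee_sum => j _; rewrite disjoint_sym in dXY.
  by have := part_length_le_setU F M j dXY hX; rewrite cX finset.setUC.
rewrite -ge0_sume_distrr; last by move=> j _; exact: part_length_ge0.
rewrite natrM EFinM -muleA; apply: lee_wpmul2l; first by rewrite lee_fin.
have := @part_sigma_setU_le F R _ M z X Y i d dXY; rewrite cX cY => /(_ (leqnn _)).
by rewrite -addSn big_addn addnK.
Qed.

(** Each [x s] lies in its own ideal, hence in [m], hence has a power in the ideal of [y]; finitely
    many exponents admit a common bound. *)
Lemma system_of_parameters_expr (R : comNzRingType) (m : {pred R}) (d : nat)
    (x y : 'I_d -> R) :
  system_of_parameters m x -> system_of_parameters m y ->
  exists2 k, (0 < k)%N &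
    forall s : 'I_d, lspan (y : 'I_d -> R^o) (x s ^+ k : R^o).
Proof.
move=> hx hy.
have h s : exists k, lspan (y : 'I_d -> R^o) (x s ^+ k : R^o).
  apply/hy/hx; exists 1%N; exists (fun t => (t == s)%:R).
  rewrite (bigD1 s) //= eqxx scale1r expr1 big1 ?addr0 // => t /negbTE ->.
  by rewrite scale0r.
have [k hk] := choice h.
(* The sum dominates every [k s]; the successor makes the exponent positive, and with it the final
   constants. *)
exists (\sum_s k s).+1 => // s.
have [c xc] := hk s.
have ks : (k s <= (\sum_s k s).+1)%N by rewrite ltnW // ltnS (bigD1 s) //= leq_addr.
exists (fun t => x s ^+ ((\sum_s k s).+1 - k s) * c t).
rewrite -[in LHS](subnK ks) exprD xc mulr_sumr; apply: eq_bigr => t _.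
exact: mulrA.
Qed.

Theorem theorem4p6 (F : realType) (R : comNzRingType) (m : {pred R}) (d : nat)
    (x y : 'I_d -> R)
    (hR : local_ring m) (hd : krull_dim R d)
    (hx : system_of_parameters m x) (hy : system_of_parameters m y) :
  exists C C' : F, [/\ 0 < C, 0 < C' &
    forall (i : nat) (M : lmodType R),
      (1 <= i <= d)%N -> finitely_generated M ->
      (koszul_sigma F x M i <= C%:E * koszul_sigma F y M i)%E /\
      (koszul_sigma F y M i <= C'%:E * koszul_sigma F x M i)%E].
Proof.
have [k k0 yx] := system_of_parameters_expr hy hx.
have [l l0 xy] := system_of_parameters_expr hx hy.
(* The exponent [k] puts powers of [y] into the ideal of [x], so it bounds the sums of [x] by those
   of [y]; [l] serves the other direction. Both are chosen before [i] and [M]. *)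
exists (k ^ d * 2 ^ d)%:R, (l ^ d * 2 ^ d)%:R; split.
- by rewrite ltr0n muln_gt0 !expn_gt0 k0.
- by rewrite ltr0n muln_gt0 !expn_gt0 l0.
- by move=> i M _ _; split; exact: koszul_sigma_le.
Qed.
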